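(* The equivalence \[ q_{\varepsilon}\in a\iff\iota(q-\varepsilon)<a<\iota(q+\varepsilon) \] holds for all real numbers $a$ (minimal rational Cauchy filters) and all rational numbers $q$ and $\varepsilon>0$.
   Context: For $q\in\mathbb{Q}$ and rational $\varepsilon>0$ let $q_\varepsilon=\{x\in\mathbb{Q}\mid q-\varepsilon<x<q+\varepsilon\}$. A (rational) filter is a non-empty collection $\mathcal{F}$ of subsets of $\mathbb{Q}$ closed under binary intersections and under supersets (in $\mathbb{Q}$); the improper filter $\mathcal{P}(\mathbb{Q})$ is allowed as a filter. A filter $\mathcal{F}$ is Cauchy if for every rational $\varepsilon>0$ there is $q\in\mathbb{Q}$ with $q_\varepsilon\in\mathcal{F}$. A minimal Cauchy filter is a Cauchy filter $\mathcal{F}$ such that any Cauchy filter $\mathcal{G}\subseteq\mathcal{F}$ satisfies $\mathcal{G}=\mathcal{F}$. In this statement $\mathbb{R}$ denotes the set of all minimal Cauchy filters in $\mathbb{Q}$, and its elements are called real numbers. For $A,B\subseteq\mathbb{Q}$ write $A<_\forall B$ if $\alpha<\beta$ for all $\alpha\in A$ and $\beta\in B$. For real numbers $a,b$, $a<b$ means that there exist $A\in a$ and $B\in b$ with $A<_\forall B$. For $q\in\mathbb{Q}$, $\iota(q)=\{S\subseteq\mathbb{Q}\mid q_\varepsilon\subseteq S\text{ for some rational }\varepsilon>0\}$, which is a real number. *)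

(* Defs.v *)
From mathcomp Require Import all_boot all_order all_algebra.
From mathcomp Require Import classical_sets filter.
From mathcomp Require Import lra.

Set Implicit Arguments.
Unset Strict Implicit.
Unset Printing Implicit Defensive.

Import Order.TTheory GRing.Theory Num.Theory.
Local Open Scope ring_scope.
Local Open Scope classical_set_scope.

Definition rat_ball (q e : rat) : set rat := [set x | q - e < x < q + e].

(* The library's [Filter] asks for [setT] instead of non-emptiness, and does
   not exclude the improper filter. *)
Lemma FilterE (F : set_system rat) :
  Filter F <->
  [/\ F !=set0,
      forall A B, F A -> F B -> F (A `&` B) &
      forall A B, A `<=` B -> F A -> F B].
Proof.
split=> [[FT FI FS]|[[A FA] FI FS]]; first by split=> //; exists setT.
by split=> //; apply: FS FA.
Qed.

Definition cauchy_filter (F : set_system rat) : Prop :=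
  Filter F /\ forall e : rat, 0 < e -> exists q : rat, F (rat_ball q e).

Definition minimal_cauchy_filter (F : set_system rat) : Prop :=
  cauchy_filter F /\
  forall G : set_system rat, cauchy_filter G -> G `<=` F -> G = F.

Record real := Real {
  real_filter : set_system rat;
  real_filterP : minimal_cauchy_filter real_filter }.

Definition lt_forall (A B : set rat) : Prop :=
  forall x y : rat, A x -> B y -> x < y.

Definition real_lt (a b : real) : Prop :=
  exists A B : set rat, [/\ real_filter a A, real_filter b B & lt_forall A B].

Definition rat_filter (q : rat) : set_system rat :=
  [set S | exists2 e : rat, 0 < e & rat_ball q e `<=` S].

Lemma rat_filter_min (q : rat) : minimal_cauchy_filter (rat_filter q).
Proof.
split.
  split; last by move=> e e0; exists q, e.
  split; first by exists 1.
    move=> A B [e e0 eA] [d d0 dB]; exists (Num.min e d).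
      by rewrite lt_min e0.
    move=> x /= /andP[x1 x2].
    have me : Num.min e d <= e by rewrite ge_min lexx.
    have md : Num.min e d <= d by rewrite ge_min lexx orbT.
    by split; [apply: eA|apply: dB]; rewrite /rat_ball /=; apply/andP; split; lra.
  by move=> A B AB [e e0 eA]; exists e => //; apply: subset_trans AB.
move=> G [[GT GI GS] Gc] GF; apply/seteqP; split=> // S [e e0 eS].
have e20 : 0 < e / 2 by lra.
have [p Gp] := Gc _ e20; have [d d0 dp] := GF _ Gp.
have /andP[q1 q2] : rat_ball p (e / 2) q.
  by apply: dp; rewrite /rat_ball /=; apply/andP; split; lra.
apply: GS Gp => x /andP[x1 x2]; apply: eS.
by rewrite /rat_ball /=; apply/andP; split; lra.
Qed.

Definition rat_real (q : rat) : real := Real (rat_filter_min q).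

(* Main.v *)
(** A minimal Cauchy filter [F] is round: the sets containing a uniform
    thickening of a member of [F] form a Cauchy subfilter, hence all of [F].
    Applied to the open interval (q - e, q + e), this yields a member of [a]
    that stays at positive distance from both endpoints. *)
Require Import Defs.
From mathcomp Require Import all_boot all_order all_algebra.
From mathcomp Require Import classical_sets filter.
From mathcomp Require Import lra.

Import Order.TTheory GRing.Theory Num.Theory.
Local Open Scope ring_scope.
Local Open Scope classical_set_scope.

Definition thickening (A : set rat) (d : rat) : set rat :=
  [set y | exists2 x, A x & rat_ball x d y].

Lemma thickening_sub (A B : set rat) (d e : rat) :
  A `<=` B -> d <= e -> thickening A d `<=` thickening B e.
Proof.
move=> AB de y [x Ax /andP[h1 h2]]; exists x; first exact: AB.
by apply/andP; split; lra.
Qed.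

Definition round_filter (F : set_system rat) : set_system rat :=
  [set S | exists A d, [/\ F A, 0 < d & thickening A d `<=` S]].

(** Each point is within any [d > 0] of itself, so a set lies in its own thickening. *)
Lemma round_filter_sub (F : set_system rat) : Filter F -> round_filter F `<=` F.
Proof.
move=> FF S [A [d [FA d0 AS]]]; apply: filterS FA => x Ax; apply: AS.
by exists x => //; apply/andP; split; lra.
Qed.

Lemma round_filter_cauchy (F : set_system rat) :
  cauchy_filter F -> cauchy_filter (round_filter F).
Proof.
move=> [FF Fc]; split; last first.
  move=> e e0; have e20 : 0 < e / 2 by lra.
  have [q Fq] := Fc _ e20.
  (* Thickening an [e / 2]-ball by [e / 2] stays within the [e]-ball. *)
  exists q, (rat_ball q (e / 2)), (e / 2); split=> // y [x /andP[x1 x2] /andP[y1 y2]].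
  by apply/andP; split; lra.
split.
- by exists setT, 1; split=> //; exact: filterT.
- move=> S T [A [d [FA d0 AS]]] [B [e [FB e0 BT]]].
  exists (A `&` B), (Num.min d e); split; first exact: filterI.
    by rewrite lt_min d0.
  rewrite subsetI; split; [apply: subset_trans AS | apply: subset_trans BT];
    by apply: thickening_sub; rewrite ?ge_min ?lexx ?orbT // => x [].
- move=> S T ST [A [d [FA d0 AS]]].
  by exists A, d; split=> //; apply: subset_trans ST.
Qed.

Lemma minimal_cauchy_filter_round (F : set_system rat) :
  minimal_cauchy_filter F -> round_filter F = F.
Proof.
move=> [Fc Fmin]; apply: Fmin; first exact: round_filter_cauchy.
by apply: round_filter_sub; case: Fc.
Qed.

(** Lets [lt_forall] against a member of [rat_filter q] be read as a bound by [q] itself. *)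
Lemma rat_filter_center (q : rat) (S : set rat) : rat_filter q S -> S q.
Proof. by move=> [e e0]; apply; apply/andP; split; lra. Qed.

Theorem proposition4p12 (a : real) (q e : rat) (he : 0 < e) :
  real_filter a (rat_ball q e) <->
  real_lt (rat_real (q - e)) a /\ real_lt a (rat_real (q + e)).
Proof.
have aP := real_filterP a; have [[aF _] _] := aP.
(* The converse comes first: [q - e] lies in [A] and [q + e] in [D], so [B] and [C] bound their
   common points from both sides. *)
split=> [|[[A [B [/rat_filter_center Aq aB AB]]]
           [C [D [aC /rat_filter_center Dq CD]]]]]; last first.
  apply: filterS (filterI aB aC) => x [Bx Cx].
  by apply/andP; split; [exact: AB | exact: CD].
rewrite -{1}(minimal_cauchy_filter_round _ aP) => -[A [d [aA d0 Aqe]]].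
(* Balls are open, so [x - d] and [x + d] may fall outside the thickening of [A]; the shifts by
   [d / 2] do not. The gap [d / 2] they give then serves as the radius around each endpoint. *)
have d20 : 0 < d / 2 by lra.
have Ad x : A x -> q - e + d / 2 < x /\ x < q + e - d / 2.
  move=> Ax.
  have /andP[h1 _] : rat_ball q e (x - d / 2).
    by apply: Aqe; exists x => //; apply/andP; split; lra.
  have /andP[_ h2] : rat_ball q e (x + d / 2).
    by apply: Aqe; exists x => //; apply/andP; split; lra.
  by split; lra.
split.
- exists (rat_ball (q - e) (d / 2)), A; split=> //; first by exists (d / 2).
  by move=> x y /andP[_ x2] /Ad[y1 _]; lra.
- exists A, (rat_ball (q + e) (d / 2)); split=> //; first by exists (d / 2).
  by move=> x y /Ad[_ x2] /andP[y1 _]; lra.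
Qed.
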